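(* For a group $\Gamma\subset PGL_{2n+2}(\mathbb{C})$ of type $\mathcal{L}$, the action of $\Gamma$ on $\Omega(\Gamma)$ is properly discontinuous.
   Context: Fix $n\geq1$. An $n$-plane is an $n$-dimensional projective linear subspace of $\mathbb{P}^{2n+1}$; $|\ell|$ denotes its point set. Let $N=\binom{2n+2}{n+1}-1$, $\mathbb{P}^N=\mathbb{P}(\Lambda^{n+1}\mathbb{C}^{2n+2})$, and $\mathcal{G}\subset\mathbb{P}^N$ the Grassmannian $Gr(n+1,2n+2)$ embedded by Plücker coordinates; $\hat\ell\in\mathcal{G}$ is the point of an $n$-plane $\ell$. Each $\sigma\in PGL_{2n+2}(\mathbb{C})$ induces $\hat\sigma\in PGL_{N+1}(\mathbb{C})$ via $\Lambda^{n+1}$ of a representative. For a sequence $(\tau_\nu)$ of pairwise distinct elements of $PGL_{m+1}(\mathbb{C})$, pick representatives in $GL_{m+1}(\mathbb{C})$ whose largest entry in absolute value is $1$; if they can be chosen to converge to $T\in M_{m+1}(\mathbb{C})$, the limit image is $\mathbb{P}(\operatorname{Im}T)$. For a discrete $\Gamma\subset PGL_{2n+2}(\mathbb{C})$, a sequence $(\sigma_\nu)\subset\Gamma$ is normal if it consists of distinct elements and both $(\sigma_\nu)$ and $(\hat\sigma_\nu)$ admit such convergent normalized representatives. An $n$-plane $\ell$ is a limit $n$-plane of $\Gamma$ if $\hat\ell\in\mathcal{G}\cap I(\hat\sigma_\nu)$ for some normal sequence, $I(\hat\sigma_\nu)$ being the limit image of $(\hat\sigma_\nu)$. $\Lambda(\Gamma)$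 is the union of $|\ell|$ over all limit $n$-planes, and the set of discontinuity is $\Omega(\Gamma)=\mathbb{P}^{2n+1}\setminus\Lambda(\Gamma)$. A domain is large if it contains an $n$-plane; a discrete subgroup $\Gamma$ is of type $\mathcal{L}$ if $\Omega(\Gamma)$ contains a large domain. *)

(* Defs.v *)
From HB Require Import structures.
From mathcomp Require Import all_boot all_order all_algebra.
From mathcomp Require Import complex.
From mathcomp Require Import all_classical all_reals all_analysis.
Import numFieldTopology.Exports numFieldNormedType.Exports.
Import Order.TTheory GRing.Theory Num.Theory.

Set Implicit Arguments.
Unset Strict Implicit.
Unset Printing Implicit Defensive.

Local Open Scope ring_scope.
Local Open Scope classical_set_scope.

(* the field of complex numbers, as a numClosedFieldType (so that the
   MathComp-Analysis norm topology applies to it and to its matrices) *)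
Definition Cf (R : realType) : numClosedFieldType := R[i].

Section Defs.
Variable R : realType.
Local Notation C := (Cf R).

(* ---------- projective conventions ----------------------------------------
   A point of P^m is a nonzero column vector of C^(m+1) up to nonzero scalars;
   a subset of P^m is represented by its cone (a scale-invariant set of nonzero
   vectors).  An element of PGL_(m+1)(C) is represented by any invertible
   matrix in its class; it acts by [v] |-> [A v]. *)

Definition proportional (p q : nat) (A B : 'M[C]_(p, q)) :=
  exists c : C, c != 0 /\ A = c *: B.

Definition cone (m : nat) (U : set 'cV[C]_m) :=
  (forall v, U v -> v != 0) /\ (forall v (c : C), U v -> c != 0 -> U (c *: v)).

Definition normalized_mx (p q : nat) (A : 'M[C]_(p, q)) :=
  (forall i j, `|A i j| <= 1) /\ (exists i j, `|A i j| = 1).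

Definition normalized_reps_converge (m : nat) (s : nat -> 'M[C]_m)
    (T : 'M[C]_m) :=
  exists c : nat -> C, (forall k, c k != 0) /\
    (forall k, normalized_mx (c k *: s k)) /\
    (fun k => c k *: s k) @ \oo --> T.

Definition limit_image_of (m : nat) (T : 'M[C]_m) : set 'cV[C]_m :=
  [set v | v != 0 /\ exists w : 'cV[C]_m, v = T *m w].

(* index set of Lambda^(n+1) C^(2n+2): the (n+1)-subsets of {0..2n+1};
   a subset is listed in increasing order by [enum] *)
Definition pindex (n : nat) := {S : {set 'I_(n.*2.+2)} | #|S| == n.+1}.

Definition NP (n : nat) := #|{: pindex n}|.

Definition pidx (n : nat) (a : 'I_(NP n)) : seq 'I_(n.*2.+2) :=
  enum (val (enum_val a : pindex n)).

(* an n-plane: the column span of a (2n+2) x (n+1) matrix of rank n+1 *)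
Definition nplane (n : nat) (L : 'M[C]_(n.*2.+2, n.+1)) := \rank L = n.+1.

Definition plane_pts (n : nat) (L : 'M[C]_(n.*2.+2, n.+1))
    : set 'cV[C]_(n.*2.+2) :=
  [set v | v != 0 /\ exists w : 'cV[C]_(n.+1), v = L *m w].

Definition plucker (n : nat) (L : 'M[C]_(n.*2.+2, n.+1)) : 'cV[C]_(NP n) :=
  \col_a \det (\matrix_(i < n.+1, j < n.+1) L (nth ord0 (pidx a) i) j).

(* Lambda^(n+1) of a matrix (its (n+1)-th compound matrix), so that
   plucker (A *m L) = compound A *m plucker L *)
Definition compound (n : nat) (A : 'M[C]_(n.*2.+2)) : 'M[C]_(NP n) :=
  \matrix_(a, b) \det (\matrix_(i < n.+1, j < n.+1)
                         A (nth ord0 (pidx a) i) (nth ord0 (pidx b) j)).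

(* G is the full preimage in GL_m(C) of a subgroup of PGL_m(C) *)
Definition PGL_subgroup (m : nat) (G : set 'M[C]_m) :=
  [/\ (forall g, G g -> g \in unitmx),
      G 1%:M,
      (forall g h, G g -> G h -> G (g *m h)),
      (forall g, G g -> G (invmx g)) &
      (forall g (c : C), G g -> c != 0 -> G (c *: g))].

(* every element of the subgroup is isolated in PGL_m(C) (quotient topology:
   the classes of the matrices of a neighbourhood U of g form a
   neighbourhood of [g]) *)
Definition discrete_PGL (m : nat) (G : set 'M[C]_m) :=
  forall g, G g -> exists U : set 'M[C]_m, nbhs g U /\
    forall h, G h -> (exists c : C, c != 0 /\ U (c *: h)) -> proportional h g.

Definition discrete_PGL_subgroup (m : nat) (G : set 'M[C]_m) :=
  PGL_subgroup G /\ discrete_PGL G.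

Definition normal_sequence (n : nat) (G : set 'M[C]_(n.*2.+2))
    (s : nat -> 'M[C]_(n.*2.+2)) :=
  [/\ (forall k, G (s k)),
      (forall k l, k <> l -> ~ proportional (s k) (s l)),
      (exists T, normalized_reps_converge s T) &
      (exists T', normalized_reps_converge (fun k => compound (s k)) T')].

Definition limit_nplane (n : nat) (G : set 'M[C]_(n.*2.+2))
    (L : 'M[C]_(n.*2.+2, n.+1)) :=
  nplane L /\
  exists s, normal_sequence G s /\
    exists T', normalized_reps_converge (fun k => compound (s k)) T' /\
      limit_image_of T' (plucker L).

Definition Lambda (n : nat) (G : set 'M[C]_(n.*2.+2)) : set 'cV[C]_(n.*2.+2) :=
  [set v | exists L, limit_nplane G L /\ plane_pts L v].

Definition Omega (n : nat) (G : set 'M[C]_(n.*2.+2)) : set 'cV[C]_(n.*2.+2) :=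
  [set v | v != 0 /\ ~ Lambda G v].

Definition domain (m : nat) (U : set 'cV[C]_m) :=
  cone U /\ open U /\ connected U.

Definition large_domain (n : nat) (U : set 'cV[C]_(n.*2.+2)) :=
  domain U /\ exists L, nplane L /\ plane_pts L `<=` U.

Definition type_L (n : nat) (G : set 'M[C]_(n.*2.+2)) :=
  discrete_PGL_subgroup G /\
  exists U, large_domain U /\ U `<=` Omega G.

(* ---------- proper discontinuity -------------------------------------------
   For every compact K of P^m contained in Om (every such K is the image of a
   compact set of nonzero vectors, and conversely), the set of elements
   gamma of the group (classes in PGL) with gamma K meeting K is finite. *)
Definition properly_discontinuous (m : nat) (G : set 'M[C]_m)
    (Om : set 'cV[C]_m) :=
  forall K : set 'cV[C]_m, compact K -> K `<=` Om ->
    exists gs : seq 'M[C]_m, forall g, G g ->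
      (exists x y, [/\ K x, K y & exists c : C, c != 0 /\ g *m x = c *: y]) ->
      exists2 h, h \in gs & proportional g h.

End Defs.

(* Main.v *)
(* Write the elements of a sequence in Gamma as g_k = P_k diag(d_k) Q_k with
   P_k, Q_k in a compact set of invertible matrices and d_k essentially
   decreasing in absolute value; after passing to a subsequence P_k -> P,
   Q_k -> Q and all the ratios d_(k,j) / d_(k,i) with i <= j converge.
   If d_(k,n+1) / d_(k,n) had a nonzero limit, then the limit image of the
   compound matrices would contain the Pluecker points of enough n-planes to
   cover P<e_0, ..., e_(n+1)>.  That space has dimension n + 1 in P^(2n+1), so it
   meets the n-plane contained in Omega(Gamma), a contradiction.  Hence the limit
   of the ratio is 0, and P<e_0, ..., e_n> is a limit n-plane, attracting every
   convergent sequence of points whose limit is off Q^-1<e_(n+1), ..., e_(2n+1)>.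
   The latter is a limit n-plane for the inverses g_k^-1.  So if g_k x_k = y_k
   with x_k -> x and y_k -> y, then x or y lies in Lambda(Gamma). *)
Require Import Defs.
From mathcomp Require Import all_boot all_order all_fingroup all_algebra.
From mathcomp Require Import complex.
From mathcomp Require Import all_classical all_reals all_analysis.
Import numFieldTopology.Exports numFieldNormedType.Exports.
Import Order.TTheory GRing.Theory Num.Theory.

Set Implicit Arguments.
Unset Strict Implicit.
Unset Printing Implicit Defensive.

Local Open Scope ring_scope.
Local Open Scope classical_set_scope.

(** * Convergence along increasing maps of indices *)

Lemma increasing_seq_cvg_oo (f : nat -> nat) : increasing_seq f -> f @ \oo --> \oo.
Proof.
move=> incf; apply/cvgnyPge => A; exists A => // k /= Ak.
apply: leq_trans Ak _; elim: k => // k IH.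
by apply: leq_ltn_trans IH _; rewrite (leqW_mono incf).
Qed.

Lemma increasing_seq_inj (f : nat -> nat) : increasing_seq f -> injective f.
Proof.
by move=> incf x y fxy; apply/eqP; rewrite eqn_leq -(incf x y) -(incf y x) fxy lexx.
Qed.

Lemma cvg_subseq (T : topologicalType) (u : nat -> T) (l : T) (f : nat -> nat) :
  increasing_seq f -> u @ \oo --> l -> (u \o f) @ \oo --> l.
Proof. by move=> /increasing_seq_cvg_oo incf; apply: cvg_comp. Qed.

(** * Entrywise limits of matrices, determinants and inverses *)

Section MatrixLimits.
Variable K : numFieldType.

Lemma cvg_mxP m n (A : nat -> 'M[K]_(m, n)) (B : 'M[K]_(m, n)) :
  A @ \oo --> B <-> forall i j, (A k i j @[k --> \oo] --> B i j).
Proof.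
split=> [AB i j|AB].
  exact: (cvg_comp _ (fun M : 'M[K]_(m, n) => M i j) AB (@coord_continuous K m n i j B)).
apply/cvg_ballP => e e0.
have : \forall k \near \oo, forall ij : 'I_m * 'I_n, ball (B ij.1 ij.2) e (A k ij.1 ij.2).
  by apply: filter_forall => -[i j]; move/cvg_ballP: (AB i j) => /(_ e e0).
by apply: filterS => k Bk; split => // i j; exact: (Bk (i, j)).
Qed.

Lemma cvg_prodr (I : finType) (P : pred I) (u : I -> nat -> K) (l : I -> K) :
  (forall i, P i -> u i @ \oo --> l i) ->
  \prod_(i | P i) u i k @[k --> \oo] --> \prod_(i | P i) l i.
Proof. by move=> ul; apply: cvg_big => // -[x y]; exact: mul_continuous. Qed.

Lemma cvg_sumr (I : finType) (P : pred I) (u : I -> nat -> K) (l : I -> K) :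
  (forall i, P i -> u i @ \oo --> l i) ->
  \sum_(i | P i) u i k @[k --> \oo] --> \sum_(i | P i) l i.
Proof. by move=> ul; apply: cvg_big => // -[x y]; exact: add_continuous. Qed.

Lemma cvg_mulmx m n p (A : nat -> 'M[K]_(m, n)) (B : nat -> 'M[K]_(n, p))
    (A' : 'M[K]_(m, n)) (B' : 'M[K]_(n, p)) :
  A @ \oo --> A' -> B @ \oo --> B' -> (A k *m B k) @[k --> \oo] --> A' *m B'.
Proof.
move=> /cvg_mxP AA' /cvg_mxP BB'; apply/cvg_mxP => i j.
under eq_fun do rewrite mxE.
by rewrite mxE; apply: cvg_sumr => l _; exact: cvgM.
Qed.

Lemma cvg_det n (A : nat -> 'M[K]_n) (A' : 'M[K]_n) :
  A @ \oo --> A' -> \det (A k) @[k --> \oo] --> \det A'.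
Proof.
move=> /cvg_mxP AA'; apply: cvg_sumr => s _; apply: cvgM; first exact: cvg_cst.
by apply: cvg_prodr => i _.
Qed.

(** By Cramer's formula the entries of the inverse are cofactors divided by the determinant, and
    both converge. *)
Lemma cvg_invmx n (A : nat -> 'M[K]_n) (A' : 'M[K]_n) :
  (forall k, A k \in unitmx) -> A' \in unitmx ->
  A @ \oo --> A' -> invmx (A k) @[k --> \oo] --> invmx A'.
Proof.
move=> uA uA' AA'; apply/cvg_mxP => i j.
under eq_fun do rewrite /invmx uA !mxE.
rewrite /invmx uA' !mxE; apply: cvgM.
  by apply: cvgV; [rewrite -unitfE -unitmxE | exact: cvg_det].
apply: cvgM; first exact: cvg_cst.
apply: cvg_det; move/cvg_mxP: AA' => AA'; apply/cvg_mxP => a b.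
by under eq_fun do rewrite !mxE; rewrite !mxE; exact: AA'.
Qed.

End MatrixLimits.

(** * Bolzano-Weierstrass for complex numbers, finite families and compact sets *)

Section Subsequences.
Variable R : realType.
Local Notation C := (Cf R).

Lemma cvg_complex (u : nat -> C) (a b : R) :
  (fun k => complex.Re (u k)) @ \oo --> a -> (fun k => complex.Im (u k)) @ \oo --> b ->
  u @ \oo --> (Complex a b : C).
Proof.
move=> /cvgrPdist_lt ua /cvgrPdist_lt ub; apply/cvgrPdist_lt => e e0.
(* The radius [e] is an element of [C]; positivity makes it real, so half of its real part can serve
   as tolerance for each of the two coordinates. *)
have ee : e = (complex.Re e)%:C%C by rewrite RRe_real // gtr0_real.
have r0 : 0 < complex.Re e / 2 by rewrite divr_gt0 // -ltcR -ee.
have := ub _ r0; have := ua _ r0; apply: filterS2 => k ha hb.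
rewrite {1}ee (splitr (complex.Re e)).
rewrite [X in `|X|]complexE (le_lt_trans (ler_normD _ _)) //.
rewrite rmorphD ltrD //.
  by move: ha; case: (u k) => x y /=; rewrite normc_def /= expr0n addr0 sqrtr_sqr ltcR.
rewrite normrM; move: hb; case: (u k) => x y /= hb.
rewrite !normc_def /= !expr0n /= expr1n add0r addr0 sqrtr1 sqrtr_sqr mul1r.
by rewrite ltcR.
Qed.

Lemma bounded_cvg_subseq (u : nat -> C) (M : C) : (forall k, `|u k| <= M) ->
  exists2 f : nat -> nat, increasing_seq f & exists l : C, (u \o f) @ \oo --> l.
Proof.
move=> uM.
have ReM (z : C) :
    `|z| <= M -> `|complex.Re z| <= complex.Re M /\ `|complex.Im z| <= complex.Re M.
  move=> zM; have eM : M = (complex.Re M)%:C%C.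
    by rewrite RRe_real // ger0_real // (le_trans _ zM).
  split; rewrite -lecR -eM (le_trans _ zM) //; first exact: normc_ge_Re.
  case: z {zM} => x y; rewrite -(normrN) normc_def /= -sqrtr_sqr lecR ler_wsqrtr //.
  by rewrite !sqrrN lerDr sqr_ge0.
have [f incf /cvg_ex[a fa]] : exists2 f : nat -> nat, increasing_seq f &
    cvgn ((fun k => complex.Re (u k)) \o f).
  apply: bolzano_weierstrass; exists (complex.Re M); split; first exact: num_real.
  by move=> x /ltW Mx k _; apply: le_trans Mx; have [] := ReM _ (uM k).
have [g incg /cvg_ex[b gb]] : exists2 g : nat -> nat, increasing_seq g &
    cvgn ((fun k => complex.Im (u (f k))) \o g).
  apply: bolzano_weierstrass; exists (complex.Re M); split; first exact: num_real.
  by move=> x /ltW Mx k _; apply: le_trans Mx; have [] := ReM _ (uM (f k)).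
exists (f \o g); first by move=> x y /=; rewrite incf -leEnat incg.
exists (Complex a b); apply: cvg_complex; last exact: gb.
exact: (cvg_subseq incg fa).
Qed.

Lemma bounded_cvg_subseq_fin (I : finType) (u : nat -> I -> C) (M : C) :
  (forall k i, `|u k i| <= M) ->
  exists2 f : nat -> nat, increasing_seq f &
    exists l : I -> C, forall i, u (f k) i @[k --> \oo] --> l i.
Proof.
move=> uM.
suff [f incf [l fl]] : exists2 f : nat -> nat, increasing_seq f &
    exists l : I -> C, forall i, i \in enum I -> u (f k) i @[k --> \oo] --> l i.
  by exists f => //; exists l => i; apply: fl; rewrite mem_enum.
elim: (enum I) => [|i s [f incf [l fl]]]; first by exists id => //; exists (fun=> 0).
have [g incg [a ga]] := bounded_cvg_subseq (fun k => uM (f k) i).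
exists (f \o g); first by move=> x y /=; rewrite incf -leEnat incg.
exists (fun j => if j == i then a else l j) => j; rewrite inE.
case: eqP => [-> _|_ /= js]; first exact: ga.
exact: (cvg_subseq incg (fl j js)).
Qed.

(** Compactness supplies cluster points only. A cluster point of points of [X] with ever larger
    entries is absurd, so the entries of [u] are bounded and a subsequence converges entrywise; its
    limit stays in [X] because [X] is closed. *)
Lemma compact_cvg_subseq m (X : set 'cV[C]_m) (u : nat -> 'cV[C]_m) :
  compact X -> (forall k, X (u k)) ->
  exists2 f : nat -> nat, increasing_seq f &
    exists2 l, X l & (u \o f) @ \oo --> l.
Proof.
move=> cX Xu.
have [M uM] : exists M : C, forall k i, `|u k i 0| <= M.
  apply: contrapT => /forallNP noM.
  have /choice[v vP] : forall N : nat, exists x, X x /\ exists i, N%:R < `|x i 0|.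
    move=> N; have /existsNP[k /existsNP[i ki]] := noM N%:R.
    by exists (u k); split => //; exists i; rewrite real_ltNge //; apply/negP.
  have [p [Xp pcl]] : X `&` cluster (v @ \oo) !=set0.
    by apply: cX; exists 0%N => // k _; have [] := vP k.
  have [N Np] : exists N : nat, forall i, `|p i 0| + 1 <= N%:R.
    pose r : C := \sum_i `|p i 0| + 1.
    have r0 : 0 <= r by rewrite addr_ge0 // sumr_ge0.
    exists (Num.truncn (complex.Re r)).+1 => i; apply: (@le_trans _ _ r).
      by rewrite lerD2r (bigD1 i) //= lerDl sumr_ge0.
    rewrite -(RRe_real (ger0_real r0)) -(rmorph_nat (real_complex R)) lecR.
    by rewrite ltW // truncnS_gt.
  have [_ [[k Nk <-] [_ /= pk]]] : (v @` [set k | (N <= k)%N]) `&` ball p 1 !=set0.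
    apply: pcl; last exact: (nbhsx_ballx p 1 ltr01).
    by exists N => // k Nk; exists k.
  have [_ [i ki]] := vP k.
  suff : `|v k i 0| <= N%:R by move=> /(lt_le_trans ki); rewrite ltr_nat ltnNge Nk.
  apply: le_trans (Np i); rewrite -[v k i 0](subrK (p i 0)) addrC.
  rewrite (le_trans (ler_normD _ _)) // lerD2l ltW // distrC.
  exact: pk.
have [f incf [l fl]] := bounded_cvg_subseq_fin uM.
have ul : (u \o f) @ \oo --> (\col_i l i).
  by apply/cvg_mxP => i j; rewrite ord1 mxE; exact: fl.
exists f => //; exists (\col_i l i) => //.
have cl : closed X by apply: compact_closed => //; exact: norm_hausdorff.
apply: (@closed_cvg _ _ \oo _ (u \o f) X cl _ _ ul).
by apply: nearW => k; exact: Xu.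
Qed.

End Subsequences.

(** * Index sets of Pluecker coordinates as increasing lists *)

Section PluckerIndices.
Variable n : nat.
Local Notation pos a i := (nth (@ord0 n.*2.+1) (pidx a) i).

Lemma size_pidx (a : 'I_(NP n)) : size (pidx a) = n.+1.
Proof. by rewrite /pidx -cardE; exact/eqP/(valP (enum_val a)). Qed.

Lemma uniq_pidx (a : 'I_(NP n)) : uniq (pidx a). Proof. exact: enum_uniq. Qed.

Lemma pos_inj (a : 'I_(NP n)) : injective (fun i : 'I_n.+1 => pos a i).
Proof.
by move=> i j /eqP; rewrite nth_uniq ?uniq_pidx ?size_pidx // => /eqP/val_inj.
Qed.

Lemma posP (a : 'I_(NP n)) (x : 'I_n.*2.+2) :
  reflect (exists i : 'I_n.+1, pos a i = x) (x \in pidx a).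
Proof.
apply: (iffP (nthP ord0)) => [[k]|[i <-]]; last by exists i; rewrite ?size_pidx.
by rewrite size_pidx => ltk <-; exists (Ordinal ltk).
Qed.

Lemma mem_pidx_inj (a b : 'I_(NP n)) : pidx a =i pidx b -> a = b.
Proof.
move=> ab; apply/enum_val_inj/val_inj/setP => x.
by move: (ab x); rewrite !mem_enum.
Qed.

Lemma pidx_onto (S : {set 'I_n.*2.+2}) : #|S| = n.+1 -> exists a, pidx a = enum S.
Proof.
move=> /eqP cS; exists (enum_rank (Sub S cS : pindex n)).
by rewrite /pidx enum_rankK SubK.
Qed.

(** A strictly increasing list of naturals dominates its positions. Hence the index set
    [{0, ..., n}] is dominant: comparing the pivots indexed by [a] with the leading ones involves
    only ratios of a later pivot to an earlier or equal one, and these converge. *)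
Lemma pos_ge (a : 'I_(NP n)) (i : 'I_n.+1) : (i <= pos a i)%N.
Proof.
have srt : sorted ltn (map val (pidx a)).
  rewrite /pidx /enum_mem -enumT.
  apply: (@subseq_sorted _ ltn ltn_trans _ (map val (enum 'I_n.*2.+2))).
    exact/map_subseq/filter_subseq.
  by rewrite val_enum_ord iota_ltn_sorted.
case: i; elim=> [//|i IH] lti /=.
apply: leq_ltn_trans (IH (ltnW lti)) _ => /=.
have := @sorted_ltn_nth _ ltn ltn_trans 0%N _ srt i i.+1.
rewrite !inE size_map size_pidx => /(_ (ltnW lti) lti (ltnSn i)).
by rewrite !(nth_map ord0) ?size_pidx // ltnW.
Qed.

End PluckerIndices.

(** * The Cauchy-Binet formula *)

Section CauchyBinet.
Variables (K : comPzRingType) (n : nat).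
Local Notation pos a i := (nth (@ord0 n.*2.+1) (pidx a) i).

Let mapping := {ffun 'I_n.+1 -> 'I_n.*2.+2}.

(** Expand the determinant over all maps [f] from rows to intermediate indices. Maps that are not
    injective repeat a row of [B] and contribute 0. An injective map is, in exactly one way, a
    permutation followed by the increasing list of an index set; the signs of the permutations turn
    the products of entries of [A] into a minor. *)
Lemma cauchy_binet (A : 'M[K]_(n.+1, n.*2.+2)) (B : 'M[K]_(n.*2.+2, n.+1)) :
  \det (A *m B) = \sum_(a < NP n)
    \det (\matrix_(i < n.+1, j < n.+1) A i (pos a j)) *
    \det (\matrix_(i < n.+1, j < n.+1) B (pos a i) j).
Proof.
pose D (f : mapping) := \det (\matrix_(i, j) B (f i) j).
have -> : \det (A *m B) = \sum_(f : mapping | injectiveb f) (\prod_i A i (f i)) * D f.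
  transitivity (\sum_(f : mapping) (\prod_i A i (f i)) * D f).
    transitivity (\sum_(s : 'S_n.+1) \sum_(f : mapping)
        (-1) ^+ s * \prod_i (A i (f i) * B (f i) (s i))).
      apply: eq_bigr => s _; rewrite -big_distrr /=; congr (_ * _).
      under eq_bigr do rewrite mxE.
      by rewrite bigA_distr_bigA.
    rewrite exchange_big; apply: eq_bigr => f _; rewrite big_distrr /=.
    apply: eq_bigr => s _; rewrite big_split mulrCA; congr (_ * (_ * _)).
    by apply: eq_bigr => i _; rewrite mxE.
  rewrite (bigID (fun f : mapping => injectiveb f)) /= [X in _ + X]big1 ?addr0 //.
  move=> f /injectivePn[i [j ij fij]]; rewrite /D (determinant_alternate ij) ?mulr0 //.
  by move=> k; rewrite !mxE fij.
pose h (u : 'I_(NP n) * 'S_n.+1) := [ffun i => pos u.1 (u.2 i)].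
have h_inj : injective h.
  move=> [a s] [b t] /ffunP hab.
  have {}hab i : pos a (s i) = pos b (t i) by have := hab i; rewrite !ffunE.
  have eab : a = b.
    apply: mem_pidx_inj => x; apply/posP/posP => -[i <-].
      by exists (t (s^-1 i)%g); rewrite -hab permKV.
    by exists (s (t^-1 i)%g); rewrite hab permKV.
  rewrite eab in hab *; congr (_, _); apply/permP => i.
  exact: (@pos_inj _ b).
have hP (f : mapping) :
    (f \in [set h u | u : 'I_(NP n) * 'S_n.+1]%SET) = injectiveb f.
  apply/imsetP/injectiveP => [[[a s] _ ->] i j|finj].
    by rewrite !ffunE /= => /pos_inj/perm_inj.
  have [|a aE] := @pidx_onto n [set f i | i : 'I_n.+1]%SET.
    by rewrite card_imset // card_ord.
  have fa i : f i \in pidx a by rewrite aE mem_enum imset_f.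
  have lt_i i : (index (f i) (pidx a) < n.+1)%N.
    by rewrite -[X in (_ < X)%N](size_pidx a) index_mem.
  have t_inj : injective (fun i => Ordinal (lt_i i)).
    move=> i j [] /(congr1 (nth ord0 (pidx a))).
    by rewrite !nth_index // => /finj.
  exists (a, perm t_inj) => //; apply/ffunP => i.
  by rewrite ffunE permE /= nth_index.
under eq_bigl do rewrite -hP.
rewrite big_imset /=; last by move=> u v _ _; exact: h_inj.
under eq_bigl do rewrite inE.
rewrite -(pair_big xpredT xpredT (fun a s => (\prod_i A i (h (a, s) i)) * D (h (a, s)))) /=.
apply: eq_bigr => a _; rewrite big_distrl /=; apply: eq_bigr => s _.
have -> : D (h (a, s)) = (-1) ^+ s * \det (\matrix_(i, j) B (pos a i) j).
  rewrite -(det_perm K s) -det_mulmx -row_permE; congr (\det _).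
  by apply/matrixP => i j; rewrite !mxE ffunE.
rewrite mulrCA mulrA; congr (_ * _ * _).
by apply: eq_bigr => i _; rewrite mxE ffunE.
Qed.

End CauchyBinet.

(** * Multiplicativity of compound matrices and Pluecker vectors *)

Section Compound.
Variables (R : realType) (n : nat).
Local Notation C := (Cf R).
Local Notation pos a i := (nth (@ord0 n.*2.+1) (pidx a) i).
Implicit Types (A B P : 'M[C]_n.*2.+2) (L : 'M[C]_(n.*2.+2, n.+1)).

Lemma plucker_mul A L : plucker (A *m L) = compound A *m plucker L.
Proof.
apply/colP => a; rewrite !mxE.
transitivity (\det ((\matrix_(i < n.+1, j < n.*2.+2) A (pos a i) j) *m L)).
  congr (\det _); apply/matrixP => i j; rewrite !mxE.
  by apply: eq_bigr => k _; rewrite mxE.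
rewrite cauchy_binet; apply: eq_bigr => b _; rewrite !mxE; congr (_ * _).
by congr (\det _); apply/matrixP => i j; rewrite !mxE.
Qed.

Lemma compound_mul A B : compound (A *m B) = compound A *m compound B.
Proof.
apply/matrixP => a b; rewrite !mxE.
transitivity (\det ((\matrix_(i < n.+1, j < n.*2.+2) A (pos a i) j) *m
                    (\matrix_(i < n.*2.+2, j < n.+1) B i (pos b j)))).
  congr (\det _); apply/matrixP => i j; rewrite !mxE.
  by apply: eq_bigr => k _; rewrite !mxE.
rewrite cauchy_binet; apply: eq_bigr => c _; rewrite !mxE.
by congr (_ * _); congr (\det _); apply/matrixP => i j; rewrite !mxE.
Qed.

Lemma compound1 : compound (1%:M : 'M[C]_n.*2.+2) = 1%:M.
Proof.
apply/matrixP => a b; rewrite !mxE; case: eqP => [<-|ab] /=.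
  transitivity (\det (1%:M : 'M[C]_n.+1)); last by rewrite det1.
  congr (\det _); apply/matrixP => i j.
  by rewrite !mxE (inj_eq (@pos_inj _ a)).
(* Distinct index sets of equal size: [a] has an index outside [b], which gives the minor a zero
   row. *)
have [i ib] : exists i : 'I_n.+1, pos a i \notin pidx b.
  apply/existsP; apply: contra_notT ab; rewrite negb_exists => /forallP ab.
  have sub : {subset pidx a <= pidx b}.
    by move=> x /posP[i <-]; have := ab i; rewrite negbK.
  have [ //|_ eqab] := uniq_min_size (uniq_pidx a) sub.
    by rewrite !size_pidx.
  exact: mem_pidx_inj.
rewrite (expand_det_row _ i) big1 // => j _; rewrite !mxE.
case: eqP => [ij|]; last by rewrite mul0r.
by case/negP: ib; apply/posP; exists j.
Qed.

Lemma compound_mul_diag A (d : 'rV[C]_n.*2.+2) :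
  compound (A *m diag_mx d) =
  compound A *m diag_mx (\row_a \prod_(j < n.+1) d 0 (pos a j)).
Proof.
apply/matrixP => a b; rewrite mul_mx_diag !mxE.
transitivity (\det ((\matrix_(i < n.+1, j < n.+1) A (pos a i) (pos b j)) *m
    diag_mx (\row_(j < n.+1) d 0 (pos b j)))).
  by congr (\det _); apply/matrixP => i j; rewrite !mul_mx_diag !mxE.
by rewrite det_mulmx det_diag; congr (_ * _); apply: eq_bigr => j _; rewrite mxE.
Qed.

(** Cauchy-Binet writes the determinant of [B *m L = 1], for a left inverse [B], as a combination of
    the Pluecker coordinates of [L]. *)
Lemma plucker_neq0 L : nplane L -> plucker L != 0.
Proof.
move=> rL; have /row_fullP[B BL] : row_full L by apply/eqP.
apply: contra_eq_neq (cauchy_binet B L) => L0; rewrite BL det1 big1 ?oner_neq0 //.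
by move=> a _; move/colP/(_ a): L0; rewrite !mxE => ->; rewrite mulr0.
Qed.

End Compound.

(** * Matrix factorization by elimination with complete pivoting *)

Section Pivoting.
Variable K : numFieldType.

Lemma entry_le_mx_norm m n (A : 'M[K]_(m, n)) i j : `|A i j| <= mx_norm A.
Proof. by rewrite mx_normE -[leLHS]nngE num_le; exact: (le_bigmax _ _ (i, j)). Qed.

Lemma max_entry m n (A : 'M[K]_(m.+1, n.+1)) :
  exists i0 j0, forall i j, `|A i j| <= `|A i0 j0|.
Proof.
have [A0|/mx_norm_neq0[[i0 j0] /= e]] := eqVneq (mx_norm A) 0.
  by exists 0, 0 => i j; rewrite (mx_norm_eq0 A0) !mxE.
by exists i0, j0 => i j; rewrite -e entry_le_mx_norm.
Qed.

Lemma norm_det_perm m (s : 'S_m) : `|\det (perm_mx s : 'M[K]_m)| = 1.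
Proof. by rewrite det_perm normrX normrN1 expr1n. Qed.

(* Complete pivoting bounds all multipliers by 1, and each elimination step at
   most doubles the largest remaining entry; this is a substitute for the
   singular value decomposition, with singular values known up to [2 ^+ m]. *)
Lemma complete_pivoting m (A : 'M[K]_m) (b : K) :
  (forall i j, `|A i j| <= b) ->
  exists (P Q : 'M[K]_m) (d : 'rV[K]_m),
  [/\ A = P *m diag_mx d *m Q,
      (forall i j, `|P i j| <= 1 /\ `|Q i j| <= 1),
      `|\det P| = 1 /\ `|\det Q| = 1,
      (forall i, `|d 0 i| <= 2 ^+ m * b) &
      (forall i j : 'I_m, (i <= j)%N -> `|d 0 j| <= 2 ^+ m * `|d 0 i|)].
Proof.
elim: m A b => [|m IH] A b Ab.
  exists 1%:M, 1%:M, 0; split; try by move=> [].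
    by apply/matrixP => -[].
  by rewrite !det1 normr1.
have [i0 [j0 Amax]] := max_entry A.
pose M : 'M[K]_(1 + m) := xrow 0 i0 (xcol 0 j0 A).
pose a := A i0 j0.
have AM : A = xrow 0 i0 (xcol 0 j0 M).
  by apply/matrixP => i j; rewrite !mxE !tpermK.
have Ma i j : `|M i j| <= `|a| by rewrite !mxE.
have M00 : M 0 0 = a by rewrite !mxE !tpermL.
(* If the pivot [a] is 0, then [M] is 0; as the inverse of 0 is 0, this bound and [divK] hold in
   that case too, and the elimination needs no case distinction. *)
clearbody M; have div_le i j : `|a^-1 * M i j| <= 1.
  have [a0|a0] := eqVneq a 0; first by rewrite a0 invr0 mul0r normr0.
  by rewrite normrM normfV mulrC ler_pdivrMr ?normr_gt0 // mul1r.
have divK (i j : 'I_(1 + m)) : a * (a^-1 * M i j) = M i j.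
  have [a0|a0] := eqVneq a 0; last by rewrite mulVKf.
  by have := Ma i j; rewrite a0 mul0r normr0 normr_le0 => /eqP.
pose r := ursubmx M; pose c := dlsubmx M.
(* The induction hypothesis is applied to the Schur complement of the pivot. Its entries are those
   of [M] minus a multiplier of modulus at most 1 times an entry of [M], whence the bound
   [2 * |a|]. *)
have [i j|P' [Q' [d' [SE PQ1 [detP detQ] d'b d'd]]]] :=
  IH (drsubmx M - (a^-1 *: c) *m r) (2 * `|a|).
  rewrite !mxE big_ord1 !mxE (le_trans (ler_normB _ _)) // mulr2n mulrDl mul1r.
  rewrite lerD ?Ma // normrM -[leRHS]mul1r ler_pM ?Ma ?div_le //.
have ulM : ulsubmx M = a%:M.
  by apply/matrixP => i j; rewrite !ord1 !mxE !lshift0 M00 mulr1n.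
pose P1 : 'M[K]_(1 + m) := block_mx 1%:M 0 (a^-1 *: c) P'.
pose Q1 : 'M[K]_(1 + m) := block_mx 1%:M (a^-1 *: r) 0 Q'.
pose d1 : 'rV[K]_(1 + m) := row_mx a%:M d'.
have d1l : d1 0 (lshift m 0) = a by rewrite row_mxEl mxE mulr1n.
have d1r i : d1 0 (rshift 1 i) = d' 0 i by rewrite row_mxEr.
have M1 : M = P1 *m diag_mx d1 *m Q1.
  have -> : diag_mx d1 = block_mx a%:M 0 0 (diag_mx d').
    by rewrite diag_mx_row; congr block_mx; apply/matrixP => i j; rewrite !ord1 !mxE.
  rewrite !mulmx_block !(mulmx0, mul0mx, addr0, add0r, mul1mx, mulmx1) -SE.
  rewrite -[LHS]submxK ulM; congr block_mx.
  - by apply/matrixP => i j; rewrite mul_scalar_mx !mxE divK.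
  - by apply/matrixP => i j; rewrite mul_mx_scalar !mxE divK.
  - rewrite mul_mx_scalar; apply/matrixP => i j.
    rewrite !mxE !big_ord1 !mxE addrCA -[LHS]addr0; congr (_ + _).
    by rewrite divK mulrCA mulrA subrr.
exists (xrow 0 i0 P1), (xcol 0 j0 Q1), d1; split.
- by rewrite AM M1 xrowE xcolE xrowE xcolE !mulmxA.
- have P1b i j : `|P1 i j| <= 1.
    rewrite /P1; case: (split_ordP i) => i' ->; case: (split_ordP j) => j' ->.
    + by rewrite block_mxEul mxE; case: eqP; rewrite ?normr1 ?normr0.
    + by rewrite block_mxEur mxE normr0.
    + by rewrite block_mxEdl !mxE.
    + by rewrite block_mxEdr; have [] := PQ1 i' j'.
  have Q1b i j : `|Q1 i j| <= 1.
    rewrite /Q1; case: (split_ordP i) => i' ->; case: (split_ordP j) => j' ->.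
    + by rewrite block_mxEul mxE; case: eqP; rewrite ?normr1 ?normr0.
    + by rewrite block_mxEur !mxE.
    + by rewrite block_mxEdl mxE normr0.
    + by rewrite block_mxEdr; have [] := PQ1 i' j'.
  by move=> i j; rewrite [xrow _ _ P1 i j]mxE [xcol _ _ Q1 i j]mxE.
- have detP1 : \det P1 = \det P' by rewrite det_lblock det1 mul1r.
  have detQ1 : \det Q1 = \det Q' by rewrite det_ublock det1 mul1r.
  rewrite xrowE xcolE !det_mulmx !normrM !norm_det_perm mul1r mulr1.
  by rewrite detP1 detQ1.
- move=> i; case: (split_ordP (i : 'I_(1 + m))) => i' ->.
    rewrite ord1 d1l; apply: le_trans (Ab i0 j0) _.
    by rewrite ler_peMl ?exprn_ege1 ?ler1n // (le_trans _ (Ab i0 j0)).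
  rewrite d1r (le_trans (d'b _)) // mulrA -exprSr ler_wpM2l //.
  exact: Ab.
- move=> i j; case: (split_ordP (i : 'I_(1 + m))) => i' ->;
  case: (split_ordP (j : 'I_(1 + m))) => j' -> ij.
  + by rewrite !ord1 ler_peMl ?exprn_ege1 ?ler1n.
  (* The first pivot against a later one: the absolute bound [d'b] closes this case, which is why
     the induction carries it along with the bound on ratios. *)
  + by rewrite ord1 d1l d1r exprSr -mulrA.
  + by move: ij; rewrite /= ord1.
  + rewrite !d1r (le_trans (d'd i' j' _)) // exprS -mulrA.
    by rewrite ler_peMl ?ler1n // mulr_ge0 ?exprn_ge0.
Qed.

End Pivoting.

(** * Normalized representatives and their limits *)

Section NormalizedLimits.
Variable R : realType.
Local Notation C := (Cf R).

Lemma normalized_mx_norm p q (A : 'M[C]_(p, q)) :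
  A != 0 -> normalized_mx ((mx_norm A)^-1 *: A).
Proof.
move=> A0; have N0 : mx_norm A != 0 by apply: contra_neq A0 => /mx_norm_eq0.
have [[i j] /= Nij] := mx_norm_neq0 N0.
have N_gt0 : 0 < mx_norm A by rewrite Nij normr_gt0 -normr_eq0 -Nij.
split=> [k l|].
  by rewrite mxE normrM normfV (gtr0_norm N_gt0) mulrC ler_pdivrMr // mul1r entry_le_mx_norm.
by exists i, j; rewrite mxE normrM normfV (gtr0_norm N_gt0) -Nij mulVf.
Qed.

(** Dividing by the maximum norm normalizes, and the norm is continuous and nonzero at [W]. So any
    rescaling with a nonzero limit determines the normalized limit up to a nonzero factor, hence the
    limit image. *)
Lemma normalized_reps_converge_scaled m (s : nat -> 'M[C]_m) (a : nat -> C)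
    (W : 'M[C]_m) :
  (forall k, a k != 0) -> (forall k, s k != 0) -> W != 0 ->
  (a k *: s k) @[k --> \oo] --> W ->
  exists2 t : C, t != 0 & normalized_reps_converge s (t *: W).
Proof.
move=> a0 s0 W0 sW.
have N0 (A : 'M[C]_m) : A != 0 -> mx_norm A != 0.
  by apply: contra_neq => /mx_norm_eq0.
have as0 k : a k *: s k != 0 by rewrite scaler_eq0 negb_or a0 s0.
exists (mx_norm W)^-1; first by rewrite invr_eq0 N0.
exists (fun k => (mx_norm (a k *: s k))^-1 * a k); split; [|split] => [k|k|].
- by rewrite mulf_neq0 ?invr_eq0 ?N0.
- by rewrite -scalerA; exact: normalized_mx_norm.
- under eq_fun do rewrite -scalerA.
  have Ncv : mx_norm (a k *: s k) @[k --> \oo] --> mx_norm W := cvg_norm sW.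
  apply/cvg_mxP => i j; under eq_fun do rewrite mxE.
  rewrite mxE; apply: cvgM; first by apply: cvgV; [exact: N0 | exact: Ncv].
  by move/cvg_mxP: sW.
Qed.

Lemma cvg_eq_lim (u : nat -> C) (a b : C) : u @ \oo --> a -> u @ \oo --> b -> a = b.
Proof. by move=> ua ub; exact: (cvg_unique (@norm_hausdorff _ _) ua ub). Qed.

Lemma cvg_ext_lim (u v : nat -> C) (a b : C) :
  u @ \oo --> a -> v @ \oo --> b -> u =1 v -> a = b.
Proof. by move=> ua vb uv; apply: (cvg_eq_lim ua); rewrite (funext uv). Qed.

Lemma cvg_diag_mx m (d : nat -> 'rV[C]_m) (e : 'rV[C]_m) :
  d @ \oo --> e -> diag_mx (d k) @[k --> \oo] --> diag_mx e.
Proof.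
move=> /cvg_mxP de; apply/cvg_mxP => i j.
have -> : (fun k => diag_mx (d k) i j) = (fun k => d k 0 i * (i == j)%:R).
  by apply/funext => k; rewrite mxE mulr_natr.
by rewrite mxE -[X in _ --> X]mulr_natr; exact: (cvgM (de 0 i) (cvg_cst _)).
Qed.

Lemma cvg_compound n (A : nat -> 'M[C]_n.*2.+2) (B : 'M[C]_n.*2.+2) :
  A @ \oo --> B -> compound (A k) @[k --> \oo] --> compound B.
Proof.
move=> /cvg_mxP AB; apply/cvg_mxP => a b; under eq_fun do rewrite mxE.
rewrite mxE; apply: cvg_det; apply/cvg_mxP => i j.
by under eq_fun do rewrite mxE; rewrite mxE; exact: AB.
Qed.

Lemma proportional_sym p q (A B : 'M[C]_(p, q)) : proportional A B -> proportional B A.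
Proof.
move=> [c [c0 ->]]; exists c^-1; split; first by rewrite invr_eq0.
by rewrite scalerA mulVf // scale1r.
Qed.

End NormalizedLimits.

(** * A pencil of n-planes and its Pluecker coordinates *)

Section Frames.
Variables (R : realType) (n : nat).
Local Notation C := (Cf R).
Local Notation pos a i := (nth (@ord0 n.*2.+1) (pidx a) i).

Lemma leq_frame : (n.+1 <= n.*2.+2)%N. Proof. by rewrite ltnS -addnn -addnS leq_addr. Qed.

Let wid (i : 'I_n.+1) : 'I_n.*2.+2 := widen_ord leq_frame i.

(* Columns [e_0, ..., e_(n-1), al e_n + be e_(n+1)]: an n-plane of the pencil
   spanned by <e_0, ..., e_(n-1)> inside <e_0, ..., e_(n+1)>. *)
Definition frame (al be : C) : 'M[C]_(n.*2.+2, n.+1) :=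
  \matrix_(i, j) if (j < n)%N then (i == j :> nat)%:R
                 else al *+ (i == n :> nat) + be *+ (i == n.+1 :> nat).

Lemma nplaneP (L : 'M[C]_(n.*2.+2, n.+1)) :
  nplane L <-> forall w : 'cV[C]_n.+1, L *m w = 0 -> w = 0.
Proof.
split=> [rL w Lw|L0].
  have /row_fullP[B BL] : row_full L by apply/eqP.
  by rewrite -[w]mul1mx -BL -mulmxA Lw mulmx0.
rewrite /nplane -mxrank_tr; apply/eqP; rewrite -[_ == _]/(row_free _) -kermx_eq0.
apply/eqP/row_matrixP => i; rewrite row0 -[row _ _]trmxK.
rewrite [(row i _)^T]L0 ?trmx0 //.
apply: trmx_inj; rewrite trmx_mul trmxK trmx0.
by apply/sub_kermxP; exact: row_sub.
Qed.

Lemma frame_mulE al be (w : 'cV[C]_n.+1) (i : 'I_n.*2.+2) :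
  (frame al be *m w) i 0 =
  if (i < n)%N then w (inord i) 0
  else (al *+ (i == n :> nat) + be *+ (i == n.+1 :> nat)) * w ord_max 0.
Proof.
rewrite mxE big_ord_recr /= mxE /= ltnn.
case: ltnP => [lt_in|le_ni].
  rewrite (ltn_eqF lt_in) (ltn_eqF (leqW lt_in)) !mulr0n addr0 mul0r addr0.
  rewrite (bigD1 (Ordinal lt_in)) //= big1 ?addr0 => [|j ji].
    rewrite mxE /= lt_in eqxx mul1r; congr (w _ _).
    by apply/val_inj; rewrite /= inordK // ltnW.
  rewrite mxE /= ltn_ord [(_ == _)](_ : _ = false) ?mul0r //.
  by apply: contraNF ji => /eqP ij; apply/eqP/val_inj.
rewrite big1 ?add0r // => j _; rewrite mxE /= ltn_ord.
by rewrite (gtn_eqF (leq_trans (ltn_ord j) le_ni)) mul0r.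
Qed.

Lemma nplane_frame al be : (al != 0) || (be != 0) -> nplane (frame al be).
Proof.
move=> ab0; apply/nplaneP => w /colP w0; apply/colP => j; rewrite [RHS]mxE.
have [lt_jn|le_nj] := ltnP j n.
  have := w0 (wid j); rewrite frame_mulE [RHS]mxE /= lt_jn => <-.
  by congr (w _ _); apply/val_inj; rewrite /= inordK.
have -> : j = ord_max by apply/val_inj/eqP; rewrite eqn_leq le_nj -ltnS ltn_ord.
case/orP: ab0 => ab0.
- have := w0 (inord n); rewrite frame_mulE [RHS]mxE inordK ?leq_frame // ltnn eqxx.
  rewrite (ltn_eqF (ltnSn n)) mulr1n mulr0n addr0 => /eqP.
  by rewrite mulf_eq0 (negPf ab0) => /eqP.
- have := w0 (inord n.+1); rewrite frame_mulE [RHS]mxE inordK; last first.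
    by rewrite !ltnS -addnn leq_addr.
  rewrite ltnNge leqnSn /= eqxx (gtn_eqF (ltnSn n)) mulr1n mulr0n add0r => /eqP.
  by rewrite mulf_eq0 (negPf ab0) => /eqP.
Qed.

Lemma frame_span al be t (z : 'cV[C]_n.*2.+2) :
  (forall i : 'I_n.*2.+2, (n.+1 < i)%N -> z i 0 = 0) ->
  z (inord n) 0 = al * t -> z (inord n.+1) 0 = be * t ->
  exists w, z = frame al be *m w.
Proof.
move=> z0 zn zn1.
exists (\col_(j < n.+1) if (j < n)%N then z (wid j) 0 else t).
apply/colP => i; rewrite frame_mulE !mxE /= ltnn.
have [lt_in|le_ni] := ltnP i n.
  rewrite inordK ?lt_in; last exact: leqW.
  by congr (z _ _); apply/val_inj; rewrite /= inordK // ltnW.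
have [ni|ne_ni] := eqVneq (i : nat) n.
  rewrite ni; have -> : i = inord n by apply/val_inj; rewrite /= inordK ?leq_frame.
  by rewrite (ltn_eqF (ltnSn n)) mulr1n mulr0n addr0 -zn.
have lt_ni : (n < i)%N by rewrite ltn_neqAle eq_sym ne_ni.
have [n1i|ne_n1i] := eqVneq (i : nat) n.+1.
  have -> : i = inord n.+1.
    by apply/val_inj; rewrite /= inordK // !ltnS -addnn leq_addr.
  by rewrite mulr1n mulr0n add0r -zn1.
by rewrite z0 ?mulr0n ?addr0 ?mul0r // ltn_neqAle eq_sym ne_n1i.
Qed.

(** Rows of the frame beyond [n + 1] vanish, and each of the first [n] columns is nonzero in one row
    only. A nonzero minor therefore uses the rows [0, ..., n - 1] and one more row [t], equal to [n]
    or [n + 1]; if [t] is [n + 1], the last column contributes only [be]. *)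
Lemma plucker_frame_support al be (a : 'I_(NP n)) : plucker (frame al be) a 0 != 0 ->
  exists2 t : 'I_n.*2.+2,
    t = n :> nat \/ t = n.+1 :> nat /\ be != 0 &
    forall d : 'I_n.*2.+2 -> C, \prod_(j < n.+1) d (pos a j) =
      (\prod_(i < n) d (wid (widen_ord (leqnSn n) i))) * d t.
Proof.
rewrite mxE => D0.
have row_neq0 (i : 'I_n.+1) : (pos a i <= n.+1)%N.
  apply: contraR D0; rewrite -ltnNge => lt_i; rewrite (expand_det_row _ i) big1 //.
  move=> j _; rewrite !mxE.
  rewrite (gtn_eqF lt_i) (gtn_eqF (ltnW lt_i)) !mulr0n addr0.
  case: ltnP => lt_jn; rewrite ?mul0r //.
  by rewrite (gtn_eqF (ltn_trans lt_jn (ltnW lt_i))) mul0r.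
have col_neq0 (i : 'I_n.*2.+2) : (i < n)%N -> i \in pidx a.
  move=> lt_in; apply: contraR D0 => /posP ia.
  rewrite (expand_det_col _ (inord i)) big1 // => k _; rewrite !mxE.
  rewrite inordK ?lt_in; last exact: leqW.
  case: eqP => [ki|]; last by rewrite mul0r.
  by case: ia; exists k; exact/val_inj.
pose S := [set x in pidx a]%SET; pose I := [set x : 'I_n.*2.+2 | (x < n)%N]%SET.
have cardS : #|S| = n.+1.
  by rewrite cardsE (card_uniqP (uniq_pidx a)) size_pidx.
have IS : I \subset S by apply/fintype.subsetP => x; rewrite !inE; exact: col_neq0.
have cardI : #|I| = n.
  rewrite -sum1_card (eq_bigl (fun i : 'I_n.*2.+2 => (i < n)%N)) => [|x]; last by rewrite inE.
  by rewrite (big_ord_narrow (ltnW leq_frame)) sum1_card card_ord.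
have /cards1P[t tE] : #|S :\: I|%SET == 1%N.
  by rewrite cardsD (finset.setIidPr IS) cardS cardI subSnn.
have : t \in (S :\: I)%SET by rewrite tE finset.set11.
rewrite !inE -leqNgt => /andP[le_nt ta].
have /posP[i it] := ta.
exists t.
  have := row_neq0 i; rewrite it leq_eqVlt ltnS => /orP[/eqP tn1|le_tn]; last first.
    by left; apply/eqP; rewrite eqn_leq le_tn le_nt.
  right; split => //; apply: contra_neqN D0 => /eqP be0.
  rewrite (expand_det_col _ ord_max) big1 // => k _; rewrite !mxE ltnn be0 mul0rn addr0.
  case: eqP => [kn|]; last by rewrite mulr0n mul0r.
  have : pos a k \in (S :\: I)%SET.
    by rewrite !inE kn ltnn; apply/posP; exists k.
  by rewrite tE inE => /eqP/(congr1 val)/=; rewrite kn tn1 => /eqP; rewrite ltn_eqF.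
move=> d; transitivity (\prod_(x in S) d x).
  rewrite [RHS](eq_bigl (mem (pidx a))) => [|x]; last by rewrite inE.
  by rewrite -[RHS]big_uniq ?uniq_pidx //= [RHS](big_nth ord0) size_pidx big_mkord.
rewrite (big_setID I) /= (finset.setIidPr IS) tE big_set1; congr (_ * _).
rewrite (eq_bigl (fun i : 'I_n.*2.+2 => (i < n)%N)) => [|x]; last by rewrite inE.
rewrite (big_ord_narrow (ltnW leq_frame)); apply: eq_bigr => j _.
by congr d; apply/val_inj.
Qed.

End Frames.

(** * Limit n-planes of factored sequences *)

Section FactoredLimits.
Variable R : realType.
Local Notation C := (Cf R).

(* The pivots [d k] play the role of the singular values of [s k]. *)
Record factored_limit m (s P Q : nat -> 'M[C]_m) (d : nat -> 'rV[C]_m)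
    (P' Q' : 'M[C]_m) (rho : 'I_m -> 'I_m -> C) : Prop := FactoredLimit {
  fl_eq : forall k, s k = P k *m diag_mx (d k) *m Q k;
  fl_neq0 : forall k i, d k 0 i != 0;
  fl_left : P @ \oo --> P';
  fl_right : Q @ \oo --> Q';
  fl_left_unit : P' \in unitmx;
  fl_right_unit : Q' \in unitmx;
  fl_ratio : forall i j : 'I_m, (i <= j)%N -> d k 0 j / d k 0 i @[k --> \oo] --> rho i j
}.

Lemma unitmx_factored m (P Q : 'M[C]_m) (d : 'rV[C]_m) :
  P *m diag_mx d *m Q \in unitmx -> [/\ P \in unitmx, Q \in unitmx & forall i, d 0 i != 0].
Proof.
rewrite !unitmx_mul => /andP[/andP[-> ud] ->]; split => // i.
move: ud; rewrite unitmxE det_diag unitfE; apply: contraNneq => di0.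
by rewrite (bigD1 i) //= di0 mul0r.
Qed.

(* The reversal matrix [J] puts the inverses of the pivots back in decreasing
   order. *)
Lemma factored_limit_inv m (s P Q : nat -> 'M[C]_m) d P' Q' rho :
  (forall k, s k \in unitmx) -> factored_limit s P Q d P' Q' rho ->
  let J : 'M[C]_m := \matrix_(i, j) (i == rev_ord j)%:R in
  factored_limit (fun k => invmx (s k))
    (fun k => invmx (Q k) *m J) (fun k => J *m invmx (P k))
    (fun k => \row_i (d k 0 (rev_ord i))^-1)
    (invmx Q' *m J) (J *m invmx P') (fun i j => rho (rev_ord j) (rev_ord i)).
Proof.
move=> su [sE d0 PP QQ uP uQ drho] J.
have mulJ (A : 'M[C]_m) i j : (A *m J) i j = A i (rev_ord j).
  rewrite mxE (bigD1 (rev_ord j)) //= !mxE eqxx mulr1 big1 ?addr0 // => k kj.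
  by rewrite mxE (negPf kj) mulr0.
have JJ : J *m J = 1%:M by apply/matrixP => i j; rewrite mulJ !mxE rev_ordK.
have uJ : J \in unitmx by case/mulmx1_unit: JJ.
have uPQ k : P k \in unitmx /\ Q k \in unitmx.
  by have := su k; rewrite sE => /unitmx_factored[].
split=> [k|k i|||||i j ij].
- have [uPk uQk] := uPQ k.
  apply: (can_inj (mulKmx (su k))); rewrite mulmxV // sE.
  have JDJ : J *m diag_mx (\row_i (d k 0 (rev_ord i))^-1) *m J =
      diag_mx (\row_i (d k 0 i)^-1).
    apply/matrixP => i j; rewrite mulJ mul_mx_diag !mxE rev_ordK.
    have [->|ij] := eqVneq i j; first by rewrite mul1r.
    by rewrite mul0r.
  rewrite -!mulmxA [J *m (_ *m _)]mulmxA [J *m _ *m (J *m _)]mulmxA JDJ.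
  rewrite (mulmxA (Q k)) mulmxV // mul1mx (mulmxA (diag_mx (d k))) mulmx_diag.
  have -> : diag_mx (\row_j (d k 0 j * (\row_i (d k 0 i)^-1) 0 j)) = 1%:M :> 'M[C]_m.
    by apply/matrixP => i j; rewrite !mxE mulfV.
  by rewrite mul1mx mulmxV.
- by rewrite mxE invr_eq0.
- exact: cvg_mulmx (cvg_invmx (fun k => (uPQ k).2) uQ QQ) (cvg_cst _).
- exact: cvg_mulmx (cvg_cst _) (cvg_invmx (fun k => (uPQ k).1) uP PP).
- by rewrite unitmx_mul unitmx_inv uQ.
- by rewrite unitmx_mul unitmx_inv uP uJ.
- under eq_fun do rewrite !mxE invrK mulrC.
  by apply: drho; rewrite /= leq_sub2l.
Qed.

Variable n : nat.
Local Notation pos a i := (nth (@ord0 n.*2.+1) (pidx a) i).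
Local Notation wid := (widen_ord (leq_frame n)).

Lemma nplane_mul (A : 'M[C]_n.*2.+2) (L : 'M[C]_(n.*2.+2, n.+1)) :
  A \in unitmx -> nplane L -> nplane (A *m L).
Proof. by rewrite -row_full_unit /nplane => /eqmxMfull ->. Qed.

(** A zero compound would kill the Pluecker vector of the frame, although [A] maps n-planes to
    n-planes. *)
Lemma compound_neq0 (A : 'M[C]_n.*2.+2) : A \in unitmx -> compound A != 0.
Proof.
move=> uA; have : plucker (A *m frame n 1 0) != 0.
  by apply/plucker_neq0/nplane_mul => //; apply: nplane_frame; rewrite oner_neq0.
by rewrite plucker_mul; apply: contra_neq => ->; rewrite mul0mx.
Qed.

Variable G : set 'M[C]_n.*2.+2.

(** Divided by the product [dl] of the [n + 1] leading pivots, the compounds converge to [W], with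
    diagonal part [E]. On the Pluecker support of the frame, [E] takes the values [rho n n = 1] and,
    only if [be] is nonzero, [rho n (n+1)]. It is thus invertible there, and the Pluecker vector of
    the plane lies in the image of [W]. *)
Lemma limit_nplane_frame s P Q d P' Q' rho (al be : C) :
  (forall k, G (s k)) -> (forall k l, k <> l -> ~ proportional (s k) (s l)) ->
  (forall k, s k \in unitmx) -> factored_limit s P Q d P' Q' rho ->
  (al != 0) || (be != 0) -> (be != 0 -> rho (inord n) (inord n.+1) != 0) ->
  limit_nplane G (P' *m frame n al be).
Proof.
move=> Gs sd su [sE d0 PP QQ uP uQ drho] ab0 be_rho.
have rho1 i : rho i i = 1.
  apply: (cvg_eq_lim (drho i i (leqnn i))).
  by under eq_fun do rewrite divff //; exact: cvg_cst.
pose e k : 'rV[C]_(NP n) := \row_a \prod_(j < n.+1) (d k 0 (pos a j) / d k 0 (wid j)).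
pose E : 'rV[C]_(NP n) := \row_a \prod_(j < n.+1) rho (wid j) (pos a j).
have eE : e @ \oo --> E.
  apply/cvg_mxP => i a; under eq_fun do rewrite mxE.
  rewrite mxE; apply: cvg_prodr => j _; apply: drho; exact: pos_ge.
pose dl k := \prod_(j < n.+1) d k 0 (wid j).
have dl0 k : dl k != 0 by apply/prodf_neq0 => j _.
have sc k : (dl k)^-1 *: compound (s k) = compound (P k) *m diag_mx (e k) *m compound (Q k).
  rewrite sE compound_mul compound_mul_diag scalemxAl scalemxAr.
  congr (_ *m _ *m _); apply/matrixP => a b; rewrite !mxE mulrnAr prodf_div.
  by rewrite mulrC.
pose W := compound P' *m diag_mx E *m compound Q'.
have sW : ((dl k)^-1 *: compound (s k)) @[k --> \oo] --> W.
  under eq_fun do rewrite sc.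
  apply: cvg_mulmx; last exact: cvg_compound.
  by apply: cvg_mulmx; [exact: cvg_compound | exact: cvg_diag_mx].
have E0 a : plucker (frame n al be) a 0 != 0 -> E 0 a != 0.
  move=> /plucker_frame_support[t tn prodE].
  have le_nt : (@inord n.*2.+1 n <= t)%N.
    by rewrite inordK ?leq_frame //; case: tn => [->|[-> _]].
  have -> : E 0 a = rho (inord n) t.
    apply: (cvg_eq_lim _ (drho _ _ le_nt)); move/cvg_mxP: eE => /(_ 0 a).
    suff -> : (fun k => e k 0 a) = (fun k => d k 0 t / d k 0 (inord n)) by [].
    apply/funext => k; rewrite mxE prodf_div prodE big_ord_recr /=.
    have -> : wid ord_max = inord n by apply/val_inj; rewrite /= inordK ?leq_frame.
    rewrite -mulf_div divff ?mul1r //; apply/prodf_neq0 => j _; exact: d0.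
  case: tn => [tn|[tn /be_rho]].
    have -> : t = inord n by apply/val_inj; rewrite /= tn inordK ?leq_frame.
    by rewrite rho1 oner_neq0.
  suff -> : t = inord n.+1 by [].
  by apply/val_inj; rewrite /= tn inordK // !ltnS -addnn leq_addr.
(* Where [E] vanishes so does the Pluecker coordinate, and the quotient is 0. *)
pose u := \col_a (plucker (frame n al be) a 0 / E 0 a).
have Eu : diag_mx E *m u = plucker (frame n al be).
  apply/colP => a; rewrite mul_diag_mx mxE [u _ _]mxE.
  have [->|/E0 Ea0] := eqVneq (plucker (frame n al be) a 0) 0; first by rewrite mul0r mulr0.
  by rewrite mulrC divfK.
have Wu : W *m (compound (invmx Q') *m u) = plucker (P' *m frame n al be).
  rewrite plucker_mul -Eu /W -!mulmxA; congr (_ *m (_ *m _)).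
  by rewrite mulmxA -compound_mul mulmxV // compound1 mul1mx.
have nP : nplane (P' *m frame n al be) by exact: (nplane_mul uP (nplane_frame _ ab0)).
have W0 : W != 0.
  by apply: contra_neq (plucker_neq0 nP) => W0; rewrite -Wu W0 mul0mx.
have [||t t0 sT'] := normalized_reps_converge_scaled _ _ W0 sW.
  by move=> k; rewrite invr_eq0.
  by move=> k; exact: compound_neq0.
(* Normality also asks for a limit of [s] itself. Scaling by the first pivot works: the limiting
   diagonal starts with 1, so the limit is nonzero. *)
have lim_s : exists T, normalized_reps_converge s T.
  pose F := \row_i rho ord0 i.
  have sF : ((d k 0 ord0)^-1 *: s k) @[k --> \oo] --> P' *m diag_mx F *m Q'.
    have -> : (fun k => (d k 0 ord0)^-1 *: s k) =
        (fun k => P k *m diag_mx (\row_i (d k 0 i / d k 0 ord0)) *m Q k).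
      apply/funext => k; rewrite sE scalemxAl scalemxAr; congr (_ *m _ *m _).
      by apply/matrixP => i j; rewrite !mxE mulrnAr mulrC.
    have FF : (\row_i (d k 0 i / d k 0 ord0)) @[k --> \oo] --> F.
      apply/cvg_mxP => i j; under eq_fun do rewrite mxE.
      by rewrite mxE; exact: drho.
    exact: (cvg_mulmx (cvg_mulmx PP (cvg_diag_mx FF)) QQ).
  have [|||r r0 sT] := normalized_reps_converge_scaled _ _ _ sF.
  - by move=> k; rewrite invr_eq0.
  - by move=> k; apply: contraTneq (su k) => ->; rewrite unitmxE det0 unitr0.
  - apply/eqP => PFQ; have : diag_mx F = 0.
      apply: (can_inj (mulKmx uP)); apply: (can_inj (mulmxK uQ)).
      by rewrite PFQ mulmx0 mul0mx.
    move=> /matrixP/(_ ord0 ord0); rewrite !mxE eqxx mulr1n rho1 => /eqP.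
    by rewrite oner_eq0.
  by exists (r *: (P' *m diag_mx F *m Q')).
split => //; exists s; split; first by split => //; exists (t *: W).
exists (t *: W); split => //; split; first exact: plucker_neq0.
exists (t^-1 *: (compound (invmx Q') *m u)).
by rewrite -scalemxAr -scalemxAl scalerA mulVf // scale1r Wu.
Qed.

(** In the basis given by [P'], the vanishing of the last [n] coordinates is [n] linear conditions
    on the [n + 1] coefficients of a vector of [L], so a nonzero vector survives. Its coordinates
    [n] and [n + 1] select the plane of the pencil. *)
Lemma frame_meets_nplane (P' : 'M[C]_n.*2.+2) (L : 'M[C]_(n.*2.+2, n.+1)) :
  P' \in unitmx -> nplane L ->
  exists v al be, [/\ plane_pts L v, (al != 0) || (be != 0) &
                      plane_pts (P' *m frame n al be) v].
Proof.
move=> uP nL.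
pose B : 'M[C]_(n, n.+1) := \matrix_(i, j) (invmx P' *m L) (inord (n.+2 + i)) j.
have [u u0 Bu] : exists2 u : 'cV[C]_n.+1, u != 0 & B *m u = 0.
  have : kermx B^T != 0.
    rewrite kermx_eq0 /row_free neq_ltn; apply/orP; left.
    by rewrite ltnS rank_leq_col.
  case/rowV0Pn => v /sub_kermxP vB v0; exists v^T; first by rewrite trmx_eq0.
  by apply: trmx_inj; rewrite trmx_mul trmxK trmx0.
pose z := invmx P' *m (L *m u).
have z_gt (i : 'I_n.*2.+2) : (n.+1 < i)%N -> z i 0 = 0.
  move=> lt_i; have lt_in : (i - n.+2 < n)%N.
    by rewrite ltn_subLR // addSn addSn addnn.
  have /colP/(_ (Ordinal lt_in)) := Bu; rewrite [RHS]mxE => <-.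
  rewrite /z mulmxA !mxE; apply: eq_bigr => j _; rewrite [B _ _]mxE /=.
  by rewrite subnKC // inord_val.
have [al [be [t [ab0 zn zn1]]]] : exists al be t, [/\ (al != 0) || (be != 0),
    z (inord n) 0 = al * t & z (inord n.+1) 0 = be * t].
  have [z0|z0] := boolP ((z (inord n) 0 != 0) || (z (inord n.+1) 0 != 0)).
    by exists (z (inord n) 0), (z (inord n.+1) 0), 1; rewrite !mulr1.
  (* The point lies in [<e_0, ..., e_(n-1)>], common to the whole pencil, so any pair other than
     [(0, 0)] serves. *)
  move: z0; rewrite negb_or !negbK => /andP[/eqP -> /eqP ->].
  by exists 1, 0, 0; rewrite oner_neq0 !mulr0.
have [w zw] := frame_span z_gt zn zn1.
have Lu0 : L *m u != 0.
  by apply: contra_neq u0; move/nplaneP: nL; apply.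
exists (L *m u), al, be; split => //; first by split => //; exists u.
by split => //; exists w; rewrite -mulmxA -zw mulKVmx.
Qed.

(* Otherwise all the frames [frame n al be] yield limit n-planes; together they
   sweep out a projective subspace of dimension [n + 1], which meets [L]. *)
Lemma middle_ratio_eq0 s P Q d P' Q' rho (L : 'M[C]_(n.*2.+2, n.+1)) :
  nplane L -> plane_pts L `<=` Omega G ->
  (forall k, G (s k)) -> (forall k l, k <> l -> ~ proportional (s k) (s l)) ->
  (forall k, s k \in unitmx) -> factored_limit s P Q d P' Q' rho ->
  rho (inord n) (inord n.+1) = 0.
Proof.
move=> nL LOm Gs sd su fl; apply/eqP/negPn/negP => r0.
have [v [al [be [/LOm[_ vLam] ab0 vP]]]] := frame_meets_nplane (fl_left_unit fl) nL.
by apply: vLam; exists (P' *m frame n al be); split => //; apply: limit_nplane_frame fl _ _.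
Qed.

End FactoredLimits.

(** * Extraction of factored subsequences, attraction and repulsion *)

Section Dynamics.
Variable R : realType.
Local Notation C := (Cf R).

(** Pivoting bounds all entries of the outer factors by 1 and the ordered ratios by [2 ^+ m], so a
    single extraction makes everything converge. The outer determinants have modulus 1, which passes
    to the limit and keeps it invertible. *)
Lemma factored_subseq m (s : nat -> 'M[C]_m) : (forall k, s k \in unitmx) ->
  exists2 f : nat -> nat, increasing_seq f &
  exists P Q d P' Q' rho, factored_limit (s \o f) P Q d P' Q' rho.
Proof.
move=> su.
have /choice[F FP] : forall k, exists F : 'M[C]_m * 'M[C]_m * 'rV[C]_m,
  [/\ s k = F.1.1 *m diag_mx F.2 *m F.1.2,
      (forall i j, `|F.1.1 i j| <= 1 /\ `|F.1.2 i j| <= 1),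
      `|\det F.1.1| = 1 /\ `|\det F.1.2| = 1,
      (forall i, F.2 0 i != 0) &
      (forall i j : 'I_m, (i <= j)%N -> `|F.2 0 j| <= 2 ^+ m * `|F.2 0 i|)].
  move=> k.
  have [|P [Q [d [sE PQ1 detPQ _ dd]]]] := @complete_pivoting _ m (s k) (mx_norm (s k)).
    exact: entry_le_mx_norm.
  exists (P, Q, d); split => //.
  by have := su k; rewrite sE => /unitmx_factored[].
pose I := ('I_m * 'I_m)%type.
(* The summands index the entries of both outer factors and the ratios. Ratios of an earlier pivot
   to a later one may be unbounded and are set to 0. *)
pose u k (t : I + I + I) : C := match t with
  | inl (inl (i, j)) => (F k).1.1 i j
  | inl (inr (i, j)) => (F k).1.2 i j
  | inr (i, j) => if (i <= j)%N then (F k).2 0 j / (F k).2 0 i else 0 end.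
have [f incf [l ul]] : exists2 f : nat -> nat, increasing_seq f &
    exists l : I + I + I -> C, forall t, u (f k) t @[k --> \oo] --> l t.
  have le1 : 1 <= 2 ^+ m :> C by rewrite exprn_ege1 // ler1n.
  apply: (@bounded_cvg_subseq_fin _ _ u (2 ^+ m)) => k t.
  have [_ b1 _ dn0 dd] := FP k.
  case: t => [[[i j]|[i j]]|[i j]] /=; [| |case: ifP => ij].
  - by apply: le_trans le1; have [] := b1 i j.
  - by apply: le_trans le1; have [] := b1 i j.
  - by rewrite normrM normfV ler_pdivrMr ?normr_gt0 // dd.
  - by rewrite normr0 (le_trans _ le1).
have unit_lim (A : nat -> 'M[C]_m) (B : 'M[C]_m) :
    (forall k, `|\det (A k)| = 1) -> A @ \oo --> B ->
    B \in unitmx.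
  move=> detA AB; have : `|\det B| = 1.
    apply: (cvg_eq_lim (cvg_norm (cvg_det AB))).
    by under eq_fun do rewrite detA; exact: cvg_cst.
  by rewrite unitmxE unitfE -normr_eq0 => ->; rewrite oner_neq0.
have PP : (fun k => (F (f k)).1.1) @ \oo --> (\matrix_(i, j) l (inl (inl (i, j)))).
  by apply/cvg_mxP => i j; rewrite mxE; exact: (ul (inl (inl (i, j)))).
have QQ : (fun k => (F (f k)).1.2) @ \oo --> (\matrix_(i, j) l (inl (inr (i, j)))).
  by apply/cvg_mxP => i j; rewrite mxE; exact: (ul (inl (inr (i, j)))).
exists f => //.
exists (fun k => (F (f k)).1.1), (fun k => (F (f k)).1.2), (fun k => (F (f k)).2).
eexists; eexists; exists (fun i j => l (inr (i, j))); split; [| |exact: PP|exact: QQ| | |].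
- by move=> k /=; have [] := FP (f k).
- by move=> k; have [] := FP (f k).
- by apply: unit_lim PP => k; have [_ _ []] := FP (f k).
- by apply: unit_lim QQ => k; have [_ _ []] := FP (f k).
- by move=> i j ij; have := ul (inr (i, j)); rewrite /u ij.
Qed.

Variable n : nat.

(** With [q = Q x] and [z = P^-1 y] the relation reads [d_j q_j = c z_j]. Eliminating [c], over
    which there is no control, gives [z_j q_i = z_i (d_j / d_i) q_j]. In the limit, with
    [i <= n < j] and [q_i] nonzero, [z_j] vanishes. *)
Lemma image_limit_in_frame s P Q d P' Q' rho (x y : nat -> 'cV[C]_n.*2.+2) x' y' c :
  factored_limit s P Q d P' Q' rho -> (forall k, s k \in unitmx) ->
  rho (inord n) (inord n.+1) = 0 ->
  (forall k, s k *m x k = c k *: y k) -> x @ \oo --> x' -> y @ \oo --> y' ->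
  (exists2 i : 'I_n.*2.+2, (i <= n)%N & (Q' *m x') i 0 != 0) ->
  exists w, y' = P' *m frame n 1 0 *m w.
Proof.
move=> [sE d0 PP QQ uP uQ drho] su mid0 sxy xx' yy' [i le_in qi0].
have uPk k : P k \in unitmx by have := su k; rewrite sE => /unitmx_factored[].
pose z k := invmx (P k) *m y k; pose z' := invmx P' *m y'.
have zz' : z @ \oo --> z' := cvg_mulmx (cvg_invmx uPk uP PP) yy'.
have qq' := cvg_mulmx QQ xx'.
have dq k j : d k 0 j * (Q k *m x k) j 0 = c k * z k j 0.
  have /colP/(_ j) : diag_mx (d k) *m (Q k *m x k) = c k *: z k.
    by apply: (can_inj (mulKmx (uPk k))); rewrite -scalemxAr mulKVmx // -sxy sE !mulmxA.
  by rewrite mul_diag_mx mxE => ->; rewrite mxE.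
have z0 (j : 'I_n.*2.+2) : (n < j)%N -> z' j 0 = 0.
  move=> lt_nj; have ij : (i <= j)%N by rewrite (leq_trans le_in) // ltnW.
  have on : (@inord n.*2.+1 n : nat) = n by rewrite inordK // leq_frame.
  have on1 : (@inord n.*2.+1 n.+1 : nat) = n.+1 by rewrite inordK // !ltnS -addnn leq_addr.
  (* The ratio factors through the pivots [n] and [n + 1], and the middle factor tends to 0. *)
  have rho_ij : rho i j = 0.
    have le1 : (i <= @inord n.*2.+1 n)%N by rewrite on.
    have le2 : (@inord n.*2.+1 n <= @inord n.*2.+1 n.+1)%N by rewrite on on1.
    have le3 : (@inord n.*2.+1 n.+1 <= j)%N by rewrite on1.
    have := cvgM (drho _ _ le3) (cvgM (drho _ _ le2) (drho _ _ le1)).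
    rewrite mid0 mul0r mulr0 => v0; apply: (cvg_ext_lim (drho i j ij) (v0 _ _)) => k /=.
    by rewrite !mulrA !divfK.
  have /eqP : z' j 0 * (Q' *m x') i 0 = 0.
    move/cvg_mxP: zz' => zz'; move/cvg_mxP: qq' => qq'.
    have := cvgM (zz' i 0) (cvgM (drho i j ij) (qq' j 0)).
    rewrite rho_ij mul0r mulr0 => v0.
    apply: (cvg_ext_lim (cvgM (zz' j 0) (qq' i 0)) (v0 _ _)) => k /=; apply: (mulfI (d0 k i)).
    rewrite mulrCA dq [RHS]mulrCA [d k 0 i * _]mulrA [d k 0 i * _]mulrC divfK //.
    by rewrite dq mulrCA [RHS]mulrCA [z k i 0 * _]mulrC.
  by rewrite mulf_eq0 (negPf qi0) orbF => /eqP.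
have [|||w zw] := @frame_span _ n 1 0 (z' (inord n) 0) z'; rewrite ?mul1r ?mul0r //.
- by move=> j lt_nj; apply: z0; exact: ltnW.
- by apply: z0; rewrite inordK // !ltnS -addnn leq_addr.
by exists w; rewrite -mulmxA -zw mulKVmx.
Qed.

(** Reversal carries the last [n + 1] coordinates to the first ones. The plane is written with the
    left factor found in [factored_limit_inv], so that it is recognized as a limit n-plane of the
    inverses. *)
Lemma repelling_in_frame (Q' : 'M[C]_n.*2.+2) (x : 'cV[C]_n.*2.+2) :
  Q' \in unitmx -> (forall i : 'I_n.*2.+2, (i <= n)%N -> (Q' *m x) i 0 = 0) ->
  exists w, x = invmx Q' *m \matrix_(i, j) (i == rev_ord j)%:R *m frame n 1 0 *m w.
Proof.
move=> uQ q0; set J := (\matrix_(i, j) _ : 'M[C]_n.*2.+2).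
have Jmul (v : 'cV[C]_n.*2.+2) i : (J *m v) i 0 = v (rev_ord i) 0.
  rewrite mxE (bigD1 (rev_ord i)) //= big1 ?addr0 => [|k ki].
    by rewrite mxE rev_ordK eqxx mul1r.
  rewrite mxE [_ == _](_ : _ = false) ?mul0r //.
  by apply: contraNF ki => /eqP ->; rewrite rev_ordK.
have z0 (j : 'I_n.*2.+2) : (n < j)%N -> (J *m (Q' *m x)) j 0 = 0.
  have rev_le (p : nat) : (n < p)%N -> (n.*2.+2 - p.+1 <= n)%N.
    by move=> np; rewrite subSS leq_subLR -addnn -addSn leq_add2r.
  by move=> nj; rewrite Jmul q0 // rev_le.
have [|||w zw] := @frame_span _ n 1 0 ((J *m (Q' *m x)) (inord n) 0) (J *m (Q' *m x));
  rewrite ?mul1r ?mul0r //.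
- by move=> j lt_nj; apply: z0; exact: ltnW.
- by apply: z0; rewrite inordK // !ltnS -addnn leq_addr.
exists w; rewrite -!mulmxA -zw; apply: (can_inj (mulKmx uQ)).
rewrite mulKVmx //; apply/colP => i; by rewrite !Jmul rev_ordK.
Qed.

End Dynamics.

(** * Proper discontinuity: a returning sequence of distinct elements contradicts compactness inside
    [Omega G] *)

Theorem theorem4p11 (R : realType) (n : nat) (hn : (1 <= n)%N)
    (G : set 'M[Cf R]_(n.*2.+2)) :
  type_L G -> properly_discontinuous G (Omega G).
Proof.
move=> [[[Gu _ _ Ginv _] _] [U [[_ [L [nL LU]]] UOm]]] X cX XOm.
have LOm : plane_pts L `<=` Omega G by move=> v /LU/UOm.
apply: contrapT => nfin.
have /choice[pick pickP] : forall gs : seq 'M[Cf R]_n.*2.+2, exists g, [/\ G g,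
    exists xyc : 'cV[Cf R]_n.*2.+2 * 'cV[Cf R]_n.*2.+2 * Cf R,
      [/\ X xyc.1.1, X xyc.1.2 & g *m xyc.1.1 = xyc.2 *: xyc.1.2] &
    forall h, h \in gs -> ~ proportional g h].
  move=> gs; apply: contrapT => no; apply: nfin; exists gs => g Gg.
  move=> [x [y [Xx Xy [c [_ gxy]]]]].
  apply: contrapT => nh; apply: no; exists g; split => //; first by exists (x, y, c).
  by move=> h hgs gh; apply: nh; exists h.
(* Each new element avoids the classes of all earlier ones, so the sequence [g] is pairwise distinct
   in PGL. *)
pose hist := fix hist k := if k is k'.+1 then pick (hist k') :: hist k' else [::].
pose g k := pick (hist k).
have hist_mem k l : (l < k)%N -> g l \in hist k.
  elim: k => // k IH; rewrite ltnS leq_eqVlt inE => /orP[/eqP->|/IH ->].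
    by rewrite eqxx.
  by rewrite orbT.
have gG k : G (g k) by have [] := pickP (hist k).
have gd k l : k <> l -> ~ proportional (g k) (g l).
  move=> /eqP; rewrite neq_ltn => /orP[] lt_kl.
    by move=> /proportional_sym; have [_ _] := pickP (hist l); apply; exact: hist_mem.
  by have [_ _] := pickP (hist k); apply; exact: hist_mem.
have /choice[xyc xycP] k := let: And3 _ e _ := pickP (hist k) in e.
have [f1 inc1 [x' Xx' xx']] : exists2 f : nat -> nat, increasing_seq f &
    exists2 l, X l & ((fun k => (xyc k).1.1) \o f) @ \oo --> l.
  by apply: compact_cvg_subseq => // k; have [] := xycP k.
have [f2 inc2 [y' Xy' yy']] : exists2 f : nat -> nat, increasing_seq f &
    exists2 l, X l & ((fun k => (xyc (f1 k)).1.2) \o f) @ \oo --> l.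
  by apply: compact_cvg_subseq => // k; have [] := xycP (f1 k).
have [f3 inc3 [P [Q [d [P' [Q' [rho fl]]]]]]] :=
  factored_subseq (fun k => Gu _ (gG (f1 (f2 k)))).
pose f k := f1 (f2 (f3 k)).
have f_inj k l : k <> l -> f k <> f l.
  by move=> kl /(increasing_seq_inj inc1)/(increasing_seq_inj inc2)/(increasing_seq_inj inc3).
pose s k := g (f k).
have su k : s k \in unitmx by exact: Gu (gG _).
have sd k l : k <> l -> ~ proportional (s k) (s l) by move=> /f_inj; exact: gd.
have sxy k : s k *m (xyc (f k)).1.1 = (xyc (f k)).2 *: (xyc (f k)).1.2.
  by have [] := xycP (f k).
have xf : (fun k => (xyc (f k)).1.1) @ \oo --> x'.
  exact: (cvg_subseq inc3 (cvg_subseq inc2 xx')).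
have yf : (fun k => (xyc (f k)).1.2) @ \oo --> y' := cvg_subseq inc3 yy'.
have ab0 : (1 != 0 :> Cf R) || (0 != 0 :> Cf R) by rewrite oner_neq0.
have [_ x'Lam] := XOm _ Xx'; have [y'0 y'Lam] := XOm _ Xy'.
have [x'0 _] := XOm _ Xx'.
have mid0 := middle_ratio_eq0 nL LOm (fun k => gG (f k)) sd su fl.
(* Either [x'] is off the repelling n-plane, and [y'] lies in the attracting one, or [x'] lies in
   the repelling one. *)
have [exq|noq] := pselect (exists2 i : 'I_n.*2.+2, (i <= n)%N & (Q' *m x') i 0 != 0).
  have [w yw] := image_limit_in_frame fl su mid0 sxy xf yf exq.
  apply: y'Lam; exists (P' *m frame n 1 0); split; last by split => //; exists w.
  (* For [be = 0] the condition on the middle ratio is vacuous. *)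
  apply: (limit_nplane_frame (fun k => gG (f k)) sd su fl ab0).
  by rewrite eqxx.
have [|w xw] := @repelling_in_frame _ n Q' x' (fl_right_unit fl).
  by move=> i le_in; apply/eqP/negPn/negP => q0; apply: noq; exists i.
apply: x'Lam; eexists; split; last by split => //; exists w; exact: xw.
apply: (limit_nplane_frame _ _ _ (factored_limit_inv su fl) ab0).
- by move=> k; exact: Ginv (gG _).
- move=> k l kl [c [c0 scl]]; apply: (sd k l kl); exists c^-1; split.
    by rewrite invr_eq0.
  by rewrite -[s k]invmxK scl invmxZ ?invmxK // -scl unitmx_inv su.
- by move=> k; rewrite unitmx_inv.
- by rewrite eqxx.
Qed.
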